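(* Let $\alpha\in(0,2]$, $d\ge1$ and $t>0$. Then $$\mathbb E\Big[\exp\Big(\int_0^t\int_0^t p_{|s-r|}(X_s-X_r)\,dr\,ds\Big)\Big]<\infty$$ holds if and only if $d=1$.
   Context: $p_t(x)=(2\pi t)^{-d/2}\exp(-|x|^2/(2t))$ is the heat kernel on $\mathbb R^d$. $X=\{X_t\}_{t\ge0}$ is a $d$-dimensional $\alpha$-stable process started at $0$ whose density $g_\alpha(t,\cdot)$ has Fourier transform $\exp(-c_\alpha t|\xi|^\alpha)$ for some $c_\alpha>0$. *)

(* Defs.v *)
From HB Require Import structures.
From mathcomp Require Import all_boot all_order all_algebra.
From mathcomp Require Import all_classical all_reals all_analysis.
Set Implicit Arguments. Unset Strict Implicit. Unset Printing Implicit Defensive.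
Import Order.TTheory GRing.Theory Num.Theory.
Import numFieldNormedType.Exports.
Local Open Scope classical_set_scope.
Local Open Scope ring_scope.

Definition dotv (R : realType) (d : nat) (x y : 'I_d -> R) : R :=
  \sum_(i < d) x i * y i.

Definition sqnormv (R : realType) (d : nat) (x : 'I_d -> R) : R :=
  \sum_(i < d) x i ^+ 2.

Definition normv (R : realType) (d : nat) (x : 'I_d -> R) : R :=
  Num.sqrt (sqnormv x).

Definition subv (R : realType) (d : nat) (x y : 'I_d -> R) : 'I_d -> R :=
  fun i => x i - y i.

(* heat kernel p_u(x) = (2 pi u)^(-d/2) exp(-|x|^2/(2u)) on R^d
   (only meaningful for u > 0; at u = 0 it evaluates to 0, a null set
   in the double integral below) *)
Definition heat_kernel (R : realType) (d : nat) (u : R) (x : 'I_d -> R) : R :=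
  powR (2 * pi * u) (- (d%:R / 2)) * expR (- (sqnormv x / (2 * u))).

(* X is a d-dimensional alpha-stable (Levy) process started at 0 with
   characteristic exponent c |xi|^alpha, i.e. its increments are independent
   and X_t - X_s has density g_alpha(t - s, .) with Fourier transform
   exp(-c (t-s) |xi|^alpha).  Independence + law of increments is stated
   through the joint characteristic function of finitely many increments
   over consecutive times 0 <= t_0 <= t_1 <= ... <= t_n:
     E[exp(i sum_k xi_k . (X_{t_(k+1)} - X_{t_k}))]
       = prod_k exp(-c (t_(k+1) - t_k) |xi_k|^alpha),
   split into real (cos) and imaginary (sin) parts.
   The process is also assumed jointly measurable in (time, omega). *)
Definition is_stable_process (R : realType) (dT : measure_display)
    (T : measurableType dT) (P : probability T R) (d : nat) (alpha c : R)
    (X : R -> T -> 'I_d -> R) : Prop :=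
  [/\ (forall w i, X 0 w i = 0),
      (forall i, measurable_fun setT (fun p : R * T => X p.1 p.2 i)) &
      (forall (n : nat) (ts : nat -> R) (xi : nat -> 'I_d -> R),
         0 <= ts 0%N -> (forall k, ts k <= ts k.+1) ->
         let S := fun w => \sum_(k < n) dotv (xi k) (subv (X (ts k.+1) w) (X (ts k) w)) in
         (\int[P]_w (cos (S w))%:E =
            (\prod_(k < n) expR (- (c * (ts k.+1 - ts k) * powR (normv (xi k)) alpha)))%:E)%E
         /\ (\int[P]_w (sin (S w))%:E = 0)%E)].

Definition self_intersection (R : realType) (dT : measure_display)
    (T : measurableType dT) (d : nat) (X : R -> T -> 'I_d -> R) (t : R) (w : T)
    : \bar R :=
  (\int[lebesgue_measure]_(s in `[0%R, t]%classic)
     \int[lebesgue_measure]_(r in `[0%R, t]%classic)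
        (heat_kernel `|s - r| (subv (X s w) (X r w)))%:E)%E.

(* Main.v *)
(* Dropping the exponential factor bounds the kernel by (2 pi |s - r|)^(-d/2),
   which for d = 1 is integrable on the square, so the exponent is bounded by a
   deterministic constant.  For d >= 2 already the first moment of the exponent
   is infinite: since alpha <= 2, the increments X_s - X_r are tight on the scale
   sqrt |s - r| (by the truncation inequality for characteristic functions), so
   E p_{|s - r|}(X_s - X_r) >= K / |s - r|, and Tonelli's theorem applies. *)
Require Import Defs.
From HB Require Import structures.
From mathcomp Require Import all_boot all_order all_algebra.
From mathcomp Require Import all_classical all_reals all_analysis.
From mathcomp Require Import measurable_realfun ring lra.
Import Order.TTheory GRing.Theory Num.Theory.
Import numFieldNormedType.Exports.
Local Open Scope classical_set_scope.
Local Open Scope ring_scope.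

(** The integral of a nonnegative function is a supremum over the simple functions below it, so
    enlarging the function and the domain only enlarges the set of competitors; measurability never
    enters. *)
Lemma ge0_le_integral_subset {d : measure_display} {T : measurableType d} {R : realType}
    (mu : {measure set T -> \bar R}) (A B : set T) (f g : T -> \bar R) :
  A `<=` B -> (forall x, A x -> 0 <= f x)%E -> (forall x, B x -> 0 <= g x)%E ->
  (forall x, A x -> f x <= g x)%E ->
  (\int[mu]_(x in A) f x <= \int[mu]_(x in B) g x)%E.
Proof.
move=> AB f0 g0 fg; rewrite integral_mkcond [leRHS]integral_mkcond.
have fA0 x : (0 <= (f \_ A) x)%E by apply: erestrict_ge0.
have gB0 x : (0 <= (g \_ B) x)%E by apply: erestrict_ge0.
have le_fg x : ((f \_ A) x <= (g \_ B) x)%E.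
  rewrite {1}/patch; case: ifPn => [xA|_]; last exact: gB0.
  move: xA; rewrite inE => xA; rewrite /patch mem_set; last exact: AB.
  exact: fg.
rewrite !ge0_integralTE//; apply: le_ereal_sup => _ [h hf <-].
by exists h => // x; exact: le_trans (hf x) (le_fg x).
Qed.

(** * Antiderivatives of the singular kernels *)

Section calculus.
Context {R : realType}.
Implicit Types (F f : R -> R) (a b s t : R).
Local Notation mu := (@lebesgue_measure R).

(** Two-sided derivatives and continuity up to the endpoints, available for every antiderivative
    used below, supply the one-sided limits that [continuous_FTC2] asks for. *)
Lemma integral_is_derive F f a b : a <= b ->
  (forall x, a <= x <= b -> is_derive x 1 F (f x)) ->
  (forall x, a <= x <= b -> {for x, continuous f}) ->
  (\int[mu]_(x in `[a, b]) (f x)%:E = (F b - F a)%:E)%E.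
Proof.
rewrite le_eqVlt => /predU1P[<- _ _|ab dF cf].
  by rewrite set_itv1 integral_set1 subrr.
have cF x : a <= x <= b -> {for x, continuous F}.
  by move=> xab; apply/differentiable_continuous/derivable1_diffP; have [] := dF _ xab.
have bda : a <= a <= b by rewrite lexx ltW.
have bdb : a <= b <= b by rewrite lexx ltW.
rewrite (@continuous_FTC2 _ f F) ?EFinB//.
- apply/continuous_within_itvP => //; split.
  + by move=> x /[!in_itv]/= /andP[ax xb]; apply: cf; rewrite !ltW.
  + exact/cvg_at_right_filter/cf.
  + exact/cvg_at_left_filter/cf.
- split.
  + by move=> x /[!in_itv]/= /andP[ax xb]; have [] := dF x; rewrite ?ltW.
  + exact/cvg_at_right_filter/cF.
  + exact/cvg_at_left_filter/cF.
- move=> x /[!in_itv]/= /andP[ax xb]; rewrite derive1E.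
  by apply: derive_val; apply: dF; rewrite !ltW.
Qed.

Lemma is_derive_ln_subl s r : r < s ->
  is_derive r (1:R) (fun x => - ln (s - x)) (s - r)^-1.
Proof.
move=> rs; have sr : 0 < s - r by rewrite subr_gt0.
have h : is_derive r (1:R) (fun x : R => s - x) (-1).
  by apply: is_derive_eq; rewrite add0r mul1r.
have /is_deriveN := @is_derive1_comp R (@ln R) (fun x => s - x) r _ _ (is_derive1_ln sr) h.
by rewrite mulrN1 opprK.
Qed.

Lemma is_derive_sqrt_subl s r : r < s ->
  is_derive r (1:R) (fun x => - 2 * Num.sqrt (s - x)) (Num.sqrt (s - r))^-1.
Proof.
move=> rs; have sr : 0 < s - r by rewrite subr_gt0.
have h : is_derive r (1:R) (fun x : R => s - x) (-1).
  by apply: is_derive_eq; rewrite add0r mul1r.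
have h2 := @is_derive1_comp R (@Num.sqrt R) (fun x => s - x) r _ _ (is_derive1_sqrt sr) h.
have h3 : is_derive r (1:R) (fun x : R => -2 * Num.sqrt (s - x)) _ := is_deriveZ (-2) h2.
apply: is_derive_eq.
have : Num.sqrt (s - r) != 0 by rewrite gt_eqF// sqrtr_gt0.
by rewrite /GRing.scale/=; move=> ?; field.
Qed.

Lemma is_derive_sqrt_subr s r : s < r ->
  is_derive r (1:R) (fun x => 2 * Num.sqrt (x - s)) (Num.sqrt (r - s))^-1.
Proof.
move=> rs; have sr : 0 < r - s by rewrite subr_gt0.
have h : is_derive r (1:R) (fun x : R => x - s) 1.
  by apply: is_derive_eq; rewrite oppr0 addr0.
have h2 := @is_derive1_comp R (@Num.sqrt R) (fun x => x - s) r _ _ (is_derive1_sqrt sr) h.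
have h3 : is_derive r (1:R) (fun x : R => 2 * Num.sqrt (x - s)) _ := is_deriveZ 2 h2.
apply: is_derive_eq.
have : Num.sqrt (r - s) != 0 by rewrite gt_eqF// sqrtr_gt0.
by rewrite /GRing.scale/=; move=> ?; field.
Qed.
End calculus.

(** Monotone convergence in the form suited to improper integrals: a bound uniform over compact
    intervals passes to the half-open interval that ends at the singularity. *)
Lemma ge0_integral_bigcup_le {d : measure_display} {T : measurableType d}
    {R : realType} (mu : {measure set T -> \bar R}) (F : (set T)^nat)
    (f : T -> \bar R) (M : \bar R) :
  nondecreasing_seq F -> (forall n, measurable (F n)) ->
  (forall n, measurable_fun (F n) f) -> (forall n x, F n x -> (0 <= f x)%E) ->
  (forall n, (\int[mu]_(x in F n) f x <= M)%E) ->
  (\int[mu]_(x in \bigcup_n F n) f x <= M)%E.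
Proof.
move=> ndF mF mf f0 leM.
have := ge0_nondecreasing_set_cvg_integral ndF mF mf f0 (mu := mu).
move=> cvgF; rewrite -(cvg_lim _ cvgF)//; apply: lime_le.
  by apply/cvg_ex; eexists; exact: cvgF.
exact: nearW.
Qed.

(** * Convergence of the inverse square root singularity and divergence of the inverse one *)

Section singular_integrals.
Context {R : realType}.
Implicit Types (f : R -> R) (a b s t : R).
Local Notation mu := (@lebesgue_measure R).

Lemma measurable_powR_norm_sub s p :
  measurable_fun setT (fun r : R => `|s - r| `^ p).
Proof.
apply: (measurableT_comp (measurable_powR _)).
apply: measurableT_comp => //.
exact: measurable_funB.
Qed.

Lemma measurable_inv_subl s : measurable_fun `]-oo, s[ (fun r : R => ((s - r)^-1)%:E).
Proof.
apply/measurable_EFinP.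
(* On [r < s] the inverse is a real power of the distance, and that power is measurable on the whole
   line. *)
apply: (eq_measurable_fun (fun r : R => `|s - r| `^ (- 1))).
  move=> x; rewrite inE/= in_itv/= => xs.
  by rewrite powR_inv1// gtr0_norm// subr_gt0.
by apply: measurable_funTS; exact: measurable_powR_norm_sub.
Qed.

Lemma powR_normN12 (x : R) : 0 < x -> `|x| `^ (- 2^-1) = (Num.sqrt x)^-1.
Proof. by move=> x0; rewrite gtr0_norm// powRN powR12_sqrt// ltW. Qed.

Lemma continuous_inv_sqrt_subl s r : r < s ->
  {for r, continuous (fun x : R => (Num.sqrt (s - x))^-1)}.
Proof.
move=> rs; apply: cvgV; first by rewrite gt_eqF// sqrtr_gt0 subr_gt0.
apply: (continuous_comp (f := fun x => s - x)); last exact: sqrt_continuous.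
by apply: cvgB; [exact: cvg_cst|exact: cvg_id].
Qed.

Lemma continuous_inv_sqrt_subr s r : s < r ->
  {for r, continuous (fun x : R => (Num.sqrt (x - s))^-1)}.
Proof.
move=> rs; apply: cvgV; first by rewrite gt_eqF// sqrtr_gt0 subr_gt0.
apply: (continuous_comp (f := fun x => x - s)); last exact: sqrt_continuous.
by apply: cvgB; [exact: cvg_id|exact: cvg_cst].
Qed.

(** Exhaust by intervals ending at distance [1 / (n + 1)] from [s]; the boundary term of the
    antiderivative there is negative and is dropped. An interval that is empty contributes 0, below
    the nonnegative bound. *)
Lemma integral_invsqrt_left a s :
  (\int[mu]_(r in `[a, s[) (`|s - r| `^ (- 2^-1))%:E <=
   (2 * Num.sqrt (s - a))%:E)%E.
Proof.
rewrite itv_bnd_open_bigcup; apply: ge0_integral_bigcup_le => //.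
- move=> m n mn; apply/subsetPset; apply: subset_itvl.
  by rewrite bnd_simp lerB// lef_pV2 ?posrE// ler_nat.
- move=> n; apply/measurable_EFinP/measurable_funTS.
  exact: measurable_powR_norm_sub.
- move=> n; have [an|na] := leP a (s - n.+1%:R^-1); last first.
    by rewrite set_itv_ge ?bnd_simp -?ltNge// integral_set0 lee_fin mulr_ge0// sqrtr_ge0.
  have xs x : a <= x <= s - n.+1%:R^-1 -> x < s.
    by move=> /andP[_ /le_lt_trans]; apply; rewrite ltrBlDr ltrDl.
  have -> : (\int[mu]_(r in `[(a)%R, (s - n.+1%:R^-1)%R]) (`|s - r| `^ (- 2^-1))%:E =
      \int[mu]_(x in `[(a)%R, (s - n.+1%:R^-1)%R]) ((Num.sqrt (s - x))^-1)%:E)%E.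
    apply: eq_integral => x; rewrite inE/= in_itv/= => /xs xs'.
    by rewrite powR_normN12 ?subr_gt0.
  rewrite (integral_is_derive _ _ _ _ an (fun x xab => is_derive_sqrt_subl _ _ (xs x xab))
    (fun x xab => continuous_inv_sqrt_subl _ _ (xs x xab))).
  by rewrite lee_fin !mulNr opprK addrC gerBl mulr_ge0.
Qed.

Lemma integral_invsqrt_right s b :
  (\int[mu]_(r in `]s, b]) (`|s - r| `^ (- 2^-1))%:E <=
   (2 * Num.sqrt (b - s))%:E)%E.
Proof.
rewrite itv_open_bnd_bigcup; apply: ge0_integral_bigcup_le => //.
- move=> m n mn; apply/subsetPset; apply: subset_itvr.
  by rewrite bnd_simp lerD2l lef_pV2 ?posrE// ler_nat.
- move=> n; apply/measurable_EFinP/measurable_funTS.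
  exact: measurable_powR_norm_sub.
- move=> n; have [an|na] := leP (s + n.+1%:R^-1) b; last first.
    by rewrite set_itv_ge ?bnd_simp -?ltNge// integral_set0 lee_fin mulr_ge0// sqrtr_ge0.
  have sx x : s + n.+1%:R^-1 <= x <= b -> s < x.
    by move=> /andP[/(lt_le_trans _) + _]; apply; rewrite ltrDl.
  have -> : (\int[mu]_(r in `[(s + n.+1%:R^-1)%R, (b)%R]) (`|s - r| `^ (- 2^-1))%:E =
      \int[mu]_(x in `[(s + n.+1%:R^-1)%R, (b)%R]) ((Num.sqrt (x - s))^-1)%:E)%E.
    apply: eq_integral => x; rewrite inE/= in_itv/= => /sx sx'.
    by rewrite distrC powR_normN12 ?subr_gt0.
  rewrite (integral_is_derive _ _ _ _ an (fun x xab => is_derive_sqrt_subr _ _ (sx x xab))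
    (fun x xab => continuous_inv_sqrt_subr _ _ (sx x xab))).
  by rewrite lee_fin gerBl mulr_ge0// sqrtr_ge0.
Qed.

(** Splitting at [s], each side contributes at most [2 * Num.sqrt t], so the bound is uniform in
    [s]. *)
Lemma integral_invsqrt_dist t s : 0 <= s <= t ->
  (\int[mu]_(r in `[0%R, t]) (`|s - r| `^ (- 2^-1))%:E <=
   (4 * Num.sqrt t)%:E)%E.
Proof.
move=> /andP[s0 st].
have mf D : measurable_fun D (fun r : R => (`|s - r| `^ (- 2^-1))%:E).
  by apply/measurable_EFinP/measurable_funTS; exact: measurable_powR_norm_sub.
have -> : `[0, t]%classic = `[0, s] `|` `]s, t].
  by rewrite -itv_bndbnd_setU// bnd_simp.
rewrite ge0_integral_setU//=; last 2 first.
- exact: mf.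
- apply/disj_setPS => x [] /=; rewrite !in_itv/= => /andP[_ xs] /andP[+ _].
  by rewrite ltNge xs.
have -> : 4 * Num.sqrt t = 2 * Num.sqrt t + 2 * Num.sqrt t by ring.
(* Dropping the null point [r = s] makes the left piece half-open. *)
rewrite EFinD -integral_itv_bndo_bndc; last exact: mf.
apply: leeD.
- apply: (le_trans (integral_invsqrt_left _ _)).
  by rewrite lee_fin ler_pM2l// ler_wsqrtr// subr0.
- apply: (le_trans (integral_invsqrt_right _ _)).
  by rewrite lee_fin ler_pM2l// ler_wsqrtr// gerBl.
Qed.

Lemma integral_inv_dist s : 0 < s ->
  (\int[mu]_(r in `[0%R, s[) ((s - r)^-1)%:E = +oo)%E.
Proof.
move=> s0; apply/eqyP => A _.
(* Integrating only up to distance [e] from [s] gives [ln s - ln e], which is exactly the prescribed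
   level [A]. *)
pose e := s * expR (- A).
have e0 : 0 < e by rewrite mulr_gt0// expR_gt0.
have [A0|A0] := leP A 0.
  apply: (@le_trans _ _ 0%E); first by rewrite lee_fin.
  apply: integral_ge0 => x /=; rewrite in_itv/= => /andP[_ xs].
  by rewrite lee_fin invr_ge0 subr_ge0 ltW.
have es : e <= s.
  by rewrite /e -[leRHS]mulr1 ler_pM2l// -expR0 ler_expR oppr_le0 ltW.
apply: (@le_trans _ _ (\int[mu]_(r in `[0%R, (s - e)%R]) ((s - r)^-1)%:E)%E).
  have xs x : 0 <= x <= s - e -> x < s.
    by move=> /andP[_ /le_lt_trans]; apply; rewrite gtrBl.
  have es0 : 0 <= s - e by rewrite subr_ge0.
  have ci x : 0 <= x <= s - e -> {for x, continuous (fun y : R => (s - y)^-1)}.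
    move=> /xs xs'; apply: cvgV; first by rewrite gt_eqF// subr_gt0.
    by apply: cvgB; [exact: cvg_cst|exact: cvg_id].
  rewrite (integral_is_derive _ _ _ _ es0 (fun x xab => is_derive_ln_subl _ _ (xs x xab)) ci).
  rewrite lee_fin subr0 subKr /e lnM ?posrE ?expR_gt0// expRK.
  by lra.
have inv_ge0 r : r < s -> (0 <= ((s - r)^-1)%:E)%E.
  by move=> rs; rewrite lee_fin invr_ge0 subr_ge0 ltW.
apply: ge0_le_integral_subset => //.
- by apply: subset_itvl; rewrite bnd_simp gtrBl.
- move=> r /=; rewrite in_itv/= => /andP[_ re]; apply: inv_ge0.
  by rewrite (le_lt_trans re)// gtrBl.
- by move=> r /=; rewrite in_itv/= => /andP[_ /inv_ge0].
Qed.

End singular_integrals.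

(** * Tonelli's theorem with one variable restricted to a set *)

Section tonelli_domain.
Context {d1 d2 : measure_display} {T1 : measurableType d1}
  {T2 : measurableType d2} {R : realType}.
Variables (m1 : {sigma_finite_measure set T1 -> \bar R})
  (m2 : {sigma_finite_measure set T2 -> \bar R}).
Variables (f : T1 * T2 -> \bar R) (D : set T2).
Hypotheses (mf : measurable_fun setT f) (f0 : forall z, (0 <= f z)%E)
  (mD : measurable D).

(** Extending by zero reduces the restricted statement to Tonelli on the full product. *)
Let h := f \_ (setT `*` D).

Let mh : measurable_fun setT h.
Proof.
apply/(measurable_restrictT _ _).1; first exact: measurableX.
exact: measurable_funTS.
Qed.

Let h0 z : (0 <= h z)%E.
Proof. by apply: erestrict_ge0 => *; exact: f0. Qed.

Let hE x y : h (x, y) = ((fun y => f (x, y)) \_ D) y.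
Proof. by rewrite /h /patch in_setX in_setT. Qed.

Lemma measurable_fun_tonelli_domain :
  measurable_fun setT (fun x => \int[m2]_(y in D) f (x, y))%E.
Proof.
have := measurable_fun_fubini_tonelli_F (m2 := m2) h mh h0.
apply: eq_measurable_fun => x _; rewrite /fubini_F [RHS]integral_mkcond.
by apply: eq_integral => y _; rewrite hE.
Qed.

Lemma tonelli_domain :
  (\int[m1]_x \int[m2]_(y in D) f (x, y) =
   \int[m2]_(y in D) \int[m1]_x f (x, y))%E.
Proof.
transitivity (\int[m1]_x \int[m2]_y h (x, y))%E.
  apply: eq_integral => x _; rewrite [LHS]integral_mkcond.
  by apply: eq_integral => y _; rewrite hE.
rewrite fubini_tonelli// [RHS]integral_mkcond.
apply: eq_integral => y _; rewrite /patch; case: ifPn => yD.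
  by apply: eq_integral => x _; rewrite hE /patch yD.
by apply: integral0_eq => x _; rewrite hE /patch (negbTE yD).
Qed.

End tonelli_domain.

Lemma measurable_ge_norm {d : measure_display} {T : measurableType d} {R : realType}
    (Y : T -> R) (K : R) :
  measurable_fun setT Y -> measurable [set w | K <= `|Y w|].
Proof.
move=> mY; rewrite (_ : [set _ | _] = (fun w => `|Y w|) @^-1` `[K, +oo[); last first.
  by apply/seteqP; split => w /=; rewrite in_itv/= andbT.
rewrite -[X in measurable X]setTI.
have : measurable_fun setT (fun w => `|Y w|) by exact: measurableT_comp.
by apply.
Qed.

(** * Tail bounds from characteristic functions *)

Section truncation.
Context {dT : measure_display} {T : measurableType dT} {R : realType}.
Variable P : probability T R.
Local Notation mu := (@lebesgue_measure R).

Lemma integral_1Bcos (a y : R) : 0 <= a -> y != 0 ->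
  (\int[mu]_(x in `[0%R, a]) (1 - cos (x * y))%:E = (a - sin (a * y) / y)%:E)%E.
Proof.
move=> a0 y0.
pose F (x : R) := x - y^-1 * sin (x * y).
have dF (x : R) : 0 <= x <= a -> is_derive x (1:R) F (1 - cos (x * y)).
  move=> _.
  have h : is_derive x (1:R) (fun x : R => x * y) y.
    by apply: is_derive_eq; rewrite /GRing.scale/= mulr0 add0r mulr1.
  have h2 := @is_derive1_comp R (@sin R) (fun x => x * y) x _ _ (is_derive_sin (x * y)) h.
  have h3 : is_derive x (1:R) (fun x : R => y^-1 * sin (x * y)) _ := is_deriveZ y^-1 h2.
  by apply: is_derive_eq; rewrite /GRing.scale/= mulrCA mulVf// mulr1.
have cf (x : R) : 0 <= x <= a -> {for x, continuous (fun x : R => 1 - cos (x * y))}.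
  move=> _; apply: cvgB; first exact: cvg_cst.
  apply: (@continuous_comp _ _ _ (fun x : R => x * y) (@cos R)); last exact: continuous_cos.
  by apply: cvgM; [exact: cvg_id|exact: cvg_cst].
rewrite (integral_is_derive _ _ _ _ a0 dF cf) /F !mul0r sin0 mulr0 !subr0.
by rewrite mulrC.
Qed.

(* [1 - sin (a y) / (a y)], the average of [1 - cos (x y)] over [0 <= x <= a],
   is at least [1/2] once [2 / a <= |y|]. *)
Lemma tail_le_char_fun (Y : T -> R) (a e : R) : measurable_fun setT Y -> 0 < a ->
  (forall x, 0 <= x <= a -> ((1 - e)%:E <= \int[P]_w (cos (x * Y w))%:E)%E) ->
  (P [set w | 2 / a <= `|Y w|]%R <= (2 * e)%:E)%E.
Proof.
move=> mY a0 cosY.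
have mcos : measurable_fun setT (@cos R).
  by apply: continuous_measurable_fun; exact: continuous_cos.
pose A := [set w | 2 / a <= `|Y w|].
have mA : measurable A by exact: measurable_ge_norm.
pose f (z : T * R) := (1 - cos (z.2 * Y z.1))%:E.
have mf : measurable_fun setT f.
  apply/measurable_EFinP; apply: measurable_funB => //.
  apply: measurableT_comp; first exact: mcos.
  apply: measurable_funM => //; exact: measurableT_comp.
have f0 z : (0 <= f z)%E by rewrite lee_fin subr_ge0 cos_le1.
have tonelli := tonelli_domain P mu f `[0%R, a]%classic mf f0 (measurable_itv _).
(* On [A] the inner integral equals [a - sin (a * Y w) / Y w], and the quotient is at most
   [1 / |Y w| <= a / 2] in absolute value. *)
have lower : ((a / 2)%:E * P A <= \int[P]_w \int[mu]_(x in `[0%R, a]) f (w, x))%E.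
  rewrite -integral_cst//.
  apply: ge0_le_integral_subset => //.
  - by move=> w _; rewrite lee_fin divr_ge0// ltW.
  - by move=> w _; apply: integral_ge0.
  move=> w /= Aw; have Y0 : 0 < `|Y w| by apply: lt_le_trans Aw; rewrite divr_gt0.
  rewrite /f/= integral_1Bcos -?normr_gt0 ?(ltW a0)// lee_fin.
  have : sin (a * Y w) / Y w <= a / 2.
    apply: (le_trans (ler_norm _)); rewrite normrM normfV.
    rewrite ler_pdivrMr//; apply: (@le_trans _ _ 1).
      by rewrite ler_norml sin_geN1 sin_le1.
    have : 2 / a <= `|Y w| by exact: Aw.
    by rewrite ler_pdivrMr// => ?; lra.
  by lra.
(* For each frequency [x] in the interval the hypothesis bounds the expectation of
   [1 - cos (x * Y w)] by [e]. *)
have upper : (\int[mu]_(x in `[0%R, a]) \int[P]_w f (w, x) <= (e * a)%:E)%E.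
  apply: (@le_trans _ _ (\int[mu]_(x in `[0%R, a]) e%:E)%E); last first.
    rewrite integral_cst//= lebesgue_measure_itv/= lte_fin a0.
    by rewrite -EFinB subr0 -EFinM.
  apply: ge0_le_integral => //.
  - by move=> x _; apply: integral_ge0.
  - have := measurable_fun_fubini_tonelli_G (m1 := P) f mf f0.
    by move=> ?; apply: measurable_funTS.
  - move=> x /=; rewrite in_itv/= => /cosY cosx.
    have icos : P.-integrable setT (fun w => (cos (x * Y w))%:E).
      apply: measurable_bounded_integrable => //.
      + by rewrite ltey_eq fin_num_measure.
      + apply: measurableT_comp; first exact: mcos.
        exact: measurable_funM.
      + exists 1; split => // r r1 w _; apply: le_trans (ltW r1).
        by rewrite ler_norml cos_geN1 cos_le1.
    rewrite /f/= (@integralB_EFin _ _ _ P setT (cst 1) (fun w => cos (x * Y w)) measurableT)//; last first.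
      exact: finite_measure_integrable_cst.
    rewrite [X in (X - _)%E](_ : _ = 1%E); last first.
      rewrite -[LHS]/(\int[P]_w (cst 1%E w))%E integral_cst// mul1e.
      exact: probability_setT.
    move: cosx; rewrite -(fineK (integrable_fin_num _ icos))//.
    by rewrite -EFinB !lee_fin; lra.
(* Chaining the two bounds, [a / 2 * P A <= e * a]. *)
move: lower; rewrite tonelli => /le_trans/(_ upper).
rewrite -/A -(fineK (fin_num_measure P A mA)) -EFinM !lee_fin.
rewrite -ler_pdivlMl ?divr_gt0// => /le_trans; apply.
by rewrite le_eqVlt; apply/orP; left; apply/eqP; field; rewrite gt_eqF.
Qed.

End truncation.

(** * Characteristic function of one coordinate of an increment *)

Section stable_increments.
Context {R : realType} {dT : measure_display} {T : measurableType dT}.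
Variables (P : probability T R) (alpha c : R) (d : nat) (X : R -> T -> 'I_d -> R).
Hypothesis stableX : is_stable_process P alpha c X.

Lemma stable_measurable s i : measurable_fun setT (fun w => X s w i).
Proof.
case: stableX => _ /(_ i) mX _.
exact: (measurableT_comp mX (pair1_measurable s)).
Qed.

Lemma stable_increment_cos r s i x : 0 <= r <= s ->
  (\int[P]_w (cos (x * (X s w i - X r w i)))%:E =
   (expR (- (c * (s - r) * `|x| `^ alpha)))%:E)%E.
Proof.
move=> /andP[r0 rs]; case: stableX => _ _ charX.
(* A single increment: the times are [r] and then constantly [s], and the frequency is [x] times the
   [i]-th basis vector, whose norm is [|x|]. *)
have := charX 1%N (fun k => if k is 0%N then r else s)
  (fun _ j => if j == i then x else 0) r0.
case.
  by case => //= _; exact: rs.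
move=> + _; rewrite big_ord1/=.
have -> : normv (fun j : 'I_d => if j == i then x else 0) = `|x|.
  rewrite /normv /sqnormv (bigD1 i)//= eqxx big1 ?addr0 ?sqrtr_sqr//.
  by move=> j /negbTE ->; rewrite expr0n.
move=> <-; apply: eq_integral => w _.
rewrite big_ord1 /dotv (bigD1 i)//= eqxx big1 ?addr0//.
by move=> j /negbTE ->; rewrite mul0r.
Qed.

End stable_increments.

(** * Lower bound for a Gaussian functional of a tight vector *)

Section gaussian_lower_bound.
Context {R : realType} {dT : measure_display} {T : measurableType dT}.
Variables (P : probability T R).

(** When every coordinate is below [K] in absolute value, the integrand is at least [k]. By the
    union bound the exceptional event has probability at most [d / (2 d) = 1 / 2], which costs half
    of [k]. *)
Lemma integral_expRN_sqnorm_ge (d : nat) (Y : T -> 'I_d -> R) (K v : R) :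
  (0 < d)%N -> (forall i, measurable_fun setT (fun w => Y w i)) -> 0 <= v ->
  (forall i, (P [set w | K <= `|Y w i|]%R <= ((2 * d%:R)^-1)%:E)%E) ->
  ((expR (- (d%:R * K ^+ 2 * v)) / 2)%:E <=
   \int[P]_w (expR (- (sqnormv (Y w) * v)))%:E)%E.
Proof.
move=> d0 mY v0 PY.
set k := expR _; have k0 : 0 <= k by exact: expR_ge0.
pose A i := [set w | K <= `|Y w i|].
have mA i : measurable (A i) by exact: measurable_ge_norm.
have mE : measurable_fun setT (fun w => expR (- (sqnormv (Y w) * v))).
  apply: measurableT_comp => //; apply: measurableT_comp => //.
  apply: measurable_funM => //; apply: measurable_sum => i.
  exact: measurable_funX.
have mI i : measurable_fun setT (fun w => (k * \1_(A i) w)%:E).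
  by apply/measurable_EFinP; apply: measurable_funM => //; exact: measurable_indic.
have mS : measurable_fun setT (fun w => \sum_(i < d) (k * \1_(A i) w)%:E)%E.
  exact: emeasurable_sum.
have S0 w : (0 <= \sum_(i < d) (k * \1_(A i) w)%:E)%E.
  by apply: sume_ge0 => i _; rewrite lee_fin mulr_ge0.
(* Adding [k] times the indicators of the bad events makes the lower bound [k] hold at every [w];
   their integral is subtracted afterwards. *)
have : (k%:E <= \int[P]_w ((expR (- (sqnormv (Y w) * v)))%:E +
    \sum_(i < d) (k * \1_(A i) w)%:E))%E.
  have {1}-> : (k%:E = \int[P]_w (cst k%:E w))%E.
    rewrite integral_cst// -[LHS]mule1; congr (_ * _)%E.
    exact/esym/probability_setT.
  apply: ge0_le_integral => //.
    by apply: emeasurable_funD => //; exact/measurable_EFinP.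
  move=> w _; have [[i Ai]|nA] := pselect (exists i, A i w).
    rewrite (bigD1 i)//= indicE mem_set// mulr1 addeCA leeDl// adde_ge0 ?lee_fin ?expR_ge0//.
    by apply: sume_ge0 => j _; rewrite lee_fin mulr_ge0.
  apply: (@le_trans _ _ (expR (- (sqnormv (Y w) * v)))%:E); last by rewrite leeDl.
  rewrite lee_fin /k ler_expR lerN2 ler_wpM2r//.
  have -> : d%:R * K ^+ 2 = \sum_(i < d) K ^+ 2 by rewrite sumr_const card_ord mulr_natl.
  apply: ler_sum => i _; have : `|Y w i| < K.
    by rewrite ltNge; apply/negP => KY; apply: nA; exists i.
  move=> YK; rewrite -[Y w i ^+ 2]real_normK ?num_real//.
  by rewrite ler_sqr ?nnegrE// ?(ltW YK)// (le_trans _ (ltW YK)).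
rewrite ge0_integralD//; last exact/measurable_EFinP.
rewrite ge0_integral_sum//; last by move=> i w _; rewrite lee_fin mulr_ge0.
have : (\sum_(i < d) \int[P]_w (k * \1_(A i) w)%:E <= (k / 2)%:E)%E.
  apply: (@le_trans _ _ (\sum_(i < d) (k * (2 * d%:R)^-1)%:E)%E).
    apply: lee_sum => i _.
    under eq_integral do rewrite EFinM.
    rewrite ge0_integralZl_EFin//; last exact/measurable_EFinP/measurable_indic.
    rewrite integral_indic// setIT EFinM.
    by apply: lee_wpmul2l; [rewrite lee_fin|exact: PY].
  rewrite sumEFin lee_fin sumr_const card_ord -mulr_natr.
  by rewrite le_eqVlt; apply/orP; left; apply/eqP; field; rewrite pnatr_eq0 -lt0n.
move=> le2 /le_trans/(_ (leeD2l _ le2)).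
rewrite -leeBlDr// -EFinB => /(le_trans _); apply.
by rewrite lee_fin; lra.
Qed.

End gaussian_lower_bound.

(** * The heat kernel evaluated at stable increments *)

Section stable_heat_kernel.
Context {R : realType} {dT : measure_display} {T : measurableType dT}.
Variables (P : probability T R) (alpha c : R) (d : nat) (X : R -> T -> 'I_d -> R).
Hypotheses (stableX : is_stable_process P alpha c X)
  (alpha_gt0 : 0 < alpha) (alpha_le2 : alpha <= 2) (c_gt0 : 0 < c) (d_gt0 : (0 < d)%N).

(* On the diffusive scale [sqrt (s - r)] the increments are tight, as
   [(s - r)^(1 - alpha / 2)] stays bounded: this is where [alpha <= 2] enters. *)
Lemma stable_increment_tight (t : R) : 0 < t -> exists2 K : R, 0 < K &
  forall r s i, 0 <= r -> r < s -> s <= t ->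
  (P [set w | K * (s - r) `^ (2^-1) <= `|X s w i - X r w i|]%R <=
   ((2 * d%:R)^-1)%:E)%E.
Proof.
(* [q] is the power of [u = s - r] that remains in [u * v ^ alpha] when [v] is proportional to
   [1 / sqrt u]; being nonnegative, it allows [u] to be replaced by [t]. *)
move=> t0; pose q := 1 - alpha / 2.
have q0 : 0 <= q by rewrite subr_ge0 ler_pdivrMr// mul1r.
have dR0 : 0 < d%:R :> R by rewrite ltr0n.
(* Chosen so that [c * b * t ^ q = 1 / (4 d)], the defect of the characteristic function that yields
   a tail of [1 / (2 d)]; [a] then solves [a ^ alpha = b]. *)
pose b := (4 * d%:R * c * t `^ q)^-1.
have b0 : 0 < b by rewrite invr_gt0 !mulr_gt0// powR_gt0.
pose a := b `^ (alpha^-1).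
have a0 : 0 < a by exact: powR_gt0.
have aalpha : a `^ alpha = b.
  by rewrite /a -powRrM mulVf ?gt_eqF// powRr1// ltW.
exists (2 / a); first exact: divr_gt0.
move=> r s i r0 rs st; pose u := s - r.
have u0 : 0 < u by rewrite subr_gt0.
have ut : u <= t by rewrite lerBlDr (le_trans st)// lerDl.
(* Controlling frequencies up to [v] bounds the tail beyond [2 / v], which is [2 / a] times
   [sqrt u]. *)
pose v := a * u `^ (- 2^-1).
have v0 : 0 < v by rewrite mulr_gt0// powR_gt0.
have uv : u * v `^ alpha = b * u `^ q.
  rewrite /v powRM ?powR_ge0 ?(ltW a0)// aalpha -powRrM mulrCA; congr (_ * _).
  rewrite -{1}(powRr1 (ltW u0)) -powRD; last by rewrite (gt_eqF u0) implybT.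
  by congr (_ `^ _); rewrite /q; field.
have -> : 2 / a * (s - r) `^ 2^-1 = 2 / v.
  rewrite /v powRN -/u; have un0 : u `^ 2^-1 != 0 by rewrite gt_eqF// powR_gt0.
  by field; rewrite un0 gt_eqF.
have -> : (2 * d%:R)^-1 = 2 * (4 * d%:R)^-1 :> R by field; rewrite gt_eqF.
apply: (@tail_le_char_fun _ _ _ P (fun w => X s w i - X r w i)) => //.
  by apply: measurable_funB; exact: (stable_measurable _ _ _ _ _ stableX).
move=> x /andP[x0 xv].
have r0s : 0 <= r <= s by rewrite r0 ltW.
rewrite (stable_increment_cos _ _ _ _ _ stableX)//.
(* By [1 + y <= expR y] it suffices that the exponent [c * u * x ^ alpha] be at most [1 / (4 d)];
   take [x] up to [v], then [u] up to [t]. *)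
rewrite lee_fin; apply: le_trans (expR_ge1Dx _); rewrite lerD2l lerN2.
rewrite ger0_norm// -mulrA.
apply: (@le_trans _ _ (c * (u * v `^ alpha))).
  rewrite ler_pM2l// ler_pM2l//; apply: ge0_ler_powR => //; rewrite ?nnegrE//; exact: ltW.
rewrite uv; apply: (@le_trans _ _ (c * (b * t `^ q))).
  rewrite ler_pM2l// ler_pM2l//; apply: ge0_ler_powR => //; rewrite ?nnegrE//; exact: ltW.
have : t `^ q != 0 by rewrite gt_eqF// powR_gt0.
move=> tq; rewrite le_eqVlt; apply/orP; left; apply/eqP; rewrite /b.
by field; rewrite tq !gt_eqF.
Qed.

(** At distance [K * sqrt u], with [u = s - r], the Gaussian factor does not depend on [u], so its
    expectation is bounded below by a constant. The prefactor [u ^ (- d / 2)] splits as [u ^ (- 1)]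
    times [u ^ (- q)], where [q = d / 2 - 1 >= 0] and hence [u ^ (- q) >= t ^ (- q)]. *)
Lemma integral_heat_kernel_ge (t : R) : 0 < t -> (2 <= d)%N -> exists2 K : R, 0 < K &
  forall r s, 0 <= r -> r < s -> s <= t ->
  ((K * (s - r)^-1)%:E <=
   \int[P]_w (heat_kernel `|s - r| (subv (X s w) (X r w)))%:E)%E.
Proof.
move=> t0 d2; have [K K0 tight] := stable_increment_tight _ t0.
pose q := d%:R / 2 - 1 : R.
have q0 : 0 <= q by rewrite /q subr_ge0 ler_pdivlMr// mul1r ler_nat.
have pi0 := pi_gt0 R.
pose k := expR (- (d%:R * K ^+ 2 / 2)) / 2.
have k0 : 0 < k by rewrite divr_gt0// expR_gt0.
exists (k * (2 * pi)^-1 * ((2 * pi * t) `^ q)^-1).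
  have tpi0 : 0 < 2 * pi :> R by rewrite mulr_gt0.
  by apply: mulr_gt0; [apply: mulr_gt0 => //|]; rewrite invr_gt0// powR_gt0// mulr_gt0.
move=> r s r0 rs st; pose u := s - r.
have u0 : 0 < u by rewrite subr_gt0.
have ut : u <= t by rewrite lerBlDr (le_trans st)// lerDl.
rewrite -/u gtr0_norm// /heat_kernel.
under eq_integral do rewrite EFinM.
rewrite ge0_integralZl_EFin ?powR_ge0//; last first.
  apply/measurable_EFinP; apply: measurableT_comp => //; apply: measurableT_comp => //.
  apply: measurable_funM => //; apply: measurable_sum => i.
  apply: measurable_funX; apply: measurable_funB; exact: (stable_measurable _ _ _ _ _ stableX).
have mY i : measurable_fun setT (fun w => subv (X s w) (X r w) i).
  by apply: measurable_funB; exact: (stable_measurable _ _ _ _ _ stableX).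
have v0 : 0 <= (2 * u)^-1 by rewrite invr_ge0 mulr_ge0// ltW.
have := @integral_expRN_sqnorm_ge _ _ _ P d (fun w => subv (X s w) (X r w))
  (K * u `^ 2^-1) ((2 * u)^-1) d_gt0.
move=> /(_ mY v0 (fun i => tight r s i r0 rs st)).
(* Diffusive scaling: [u] cancels from the exponent. *)
have -> : d%:R * (K * u `^ 2^-1) ^+ 2 * (2 * u)^-1 = d%:R * K ^+ 2 / 2.
  rewrite powR12_sqrt ?(ltW u0)// exprMn sqr_sqrtr ?(ltW u0)//.
  by field; rewrite gt_eqF.
rewrite -/k => kle.
have p0 : 0 <= (2 * pi * u) `^ (- (d%:R / 2)) by exact: powR_ge0.
apply: (@le_trans _ _ (((2 * pi * u) `^ (- (d%:R / 2)))%:E * k%:E)%E); last first.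
  by apply: lee_wpmul2l => //; rewrite lee_fin.
rewrite -EFinM lee_fin.
have piu : 0 < 2 * pi * u by rewrite !mulr_gt0.
have -> : - (d%:R / 2) = - 1 + - q by rewrite /q; ring.
rewrite [_ `^ (- 1 + _)]powRD; last by rewrite (gt_eqF piu) implybT.
rewrite powR_inv1 ?(ltW piu)// powRN.
have : ((2 * pi * t) `^ q)^-1 <= ((2 * pi * u) `^ q)^-1.
  rewrite lef_pV2 ?posrE ?powR_gt0 ?mulr_gt0//.
  apply: ge0_ler_powR; rewrite ?nnegrE ?mulr_ge0 ?(ltW t0) ?(ltW u0) ?(ltW pi0)//.
  by rewrite ler_pM2l// mulr_gt0.
move: (((2 * pi * t) `^ q)^-1) (((2 * pi * u) `^ q)^-1) => x y xy.
have -> : k * (2 * pi)^-1 * x * u^-1 = (k * (2 * pi * u)^-1) * x.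
  by rewrite (invfM _ u); ring.
have -> : (2 * pi * u)^-1 * y * k = (k * (2 * pi * u)^-1) * y by ring.
by rewrite ler_wpM2l// mulr_ge0 ?(ltW k0)// invr_ge0 ltW.
Qed.

(** The variables are grouped as [((w, s), r)] so that integrating out [r] leaves a function of
    [(w, s)], ready for a second use of Tonelli. *)
Lemma measurable_heat_kernel_increment :
  measurable_fun setT (fun z : T * R * R =>
    (heat_kernel `|z.1.2 - z.2| (subv (X z.1.2 z.1.1) (X z.2 z.1.1)))%:E).
Proof.
have mX i : measurable_fun setT (fun p : R * T => X p.1 p.2 i).
  by case: stableX.
have mdist : measurable_fun setT (fun z : T * R * R => `|z.1.2 - z.2|).
  apply: measurableT_comp => //; apply: measurable_funB => //.
  exact: measurableT_comp.
apply/measurable_EFinP; apply: measurable_funM.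
  apply: (measurableT_comp (measurable_powR _)).
  exact: measurable_funM.
apply: measurableT_comp => //; apply: measurableT_comp => //.
apply: measurable_funM.
  apply: measurable_sum => i; apply: measurable_funX; apply: measurable_funB.
    apply: (measurableT_comp (mX i) (g := fun z : T * R * R => (z.1.2, z.1.1))).
    by apply: measurable_fun_pair; exact: measurableT_comp.
  apply: (measurableT_comp (mX i) (g := fun z : T * R * R => (z.2, z.1.1))).
  by apply: measurable_fun_pair => //; exact: measurableT_comp.
(* The inverse and the power [-1] agree on the diagonal too, where both are 0. *)
rewrite (_ : (fun _ => _) = (fun z : T * R * R => (2 * `|z.1.2 - z.2|) `^ (-1))).
  apply: (measurableT_comp (measurable_powR _)).
  exact: measurable_funM.
by apply/funext => z; rewrite powR_inv1// mulr_ge0.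
Qed.

End stable_heat_kernel.

(** * Pathwise bound for [d = 1] and infinite mean for [d >= 2] *)

Section self_intersection_local_time.
Context {R : realType} {dT : measure_display} {T : measurableType dT}.
Variables (P : probability T R).
Local Notation mu := (@lebesgue_measure R).

Lemma heat_kernel_ge0 (d : nat) (u : R) (x : 'I_d -> R) : 0 <= heat_kernel u x.
Proof. by rewrite mulr_ge0 ?powR_ge0 ?expR_ge0. Qed.

Lemma heat_kernel1_le (u : R) (x : 'I_1 -> R) : 0 <= u ->
  heat_kernel u x <= (2 * pi) `^ (- 2^-1) * u `^ (- 2^-1).
Proof.
move=> u0; rewrite /heat_kernel mul1r powRM// ?mulr_ge0 ?pi_ge0//.
rewrite ler_piMr ?mulr_ge0 ?powR_ge0// -expR0 ler_expR oppr_le0.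
by rewrite divr_ge0 ?mulr_ge0//; apply: sumr_ge0 => i _; exact: sqr_ge0.
Qed.

(** For each [s] the inner integral is at most [k * (4 * Num.sqrt t)], and the outer interval has
    length [t]. *)
Lemma self_intersection1_le (X : R -> T -> 'I_1 -> R) (t : R) w : 0 < t ->
  (self_intersection X t w <= ((2 * pi) `^ (- 2^-1) * (4 * Num.sqrt t) * t)%:E)%E.
Proof.
move=> t0; set k := (2 * pi) `^ _; have k0 : 0 <= k by exact: powR_ge0.
apply: (@le_trans _ _ (\int[mu]_(s in `[0%R, t]) (cst (k * (4 * Num.sqrt t))%:E s))%E); last first.
  rewrite integral_cst//= lebesgue_measure_itv/= lte_fin t0.
  by rewrite -EFinB subr0 -EFinM.
apply: ge0_le_integral_subset => //.
- by move=> s _; apply: integral_ge0 => r _; rewrite lee_fin heat_kernel_ge0.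
- by move=> s _; rewrite lee_fin mulr_ge0// mulr_ge0// sqrtr_ge0.
move=> s /=; rewrite in_itv/= => st.
apply: (@le_trans _ _ (\int[mu]_(r in `[0%R, t]) (k%:E * (`|s - r| `^ (- 2^-1))%:E))%E).
  apply: ge0_le_integral_subset => //.
  - by move=> r _; rewrite lee_fin heat_kernel_ge0.
  - by move=> r _; rewrite mule_ge0// lee_fin powR_ge0.
  - by move=> r _; rewrite -EFinM lee_fin heat_kernel1_le.
rewrite ge0_integralZl_EFin//; last first.
  apply/measurable_EFinP; apply: measurable_funTS.
  exact: measurable_powR_norm_sub.
by rewrite EFinM lee_wpmul2l ?lee_fin// integral_invsqrt_dist.
Qed.

Lemma ge0_self_intersection (d : nat) (X : R -> T -> 'I_d -> R) (t : R) w :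
  (0 <= self_intersection X t w)%E.
Proof.
apply: integral_ge0 => s _; apply: integral_ge0 => r _.
by rewrite lee_fin heat_kernel_ge0.
Qed.

Section with_process.
Variables (alpha c : R) (d : nat) (X : R -> T -> 'I_d -> R) (t : R).
Hypotheses (stableX : is_stable_process P alpha c X) (t_gt0 : 0 < t).

Let h (z : T * R * R) :=
  (heat_kernel `|z.1.2 - z.2| (subv (X z.1.2 z.1.1) (X z.2 z.1.1)))%:E.

Let mh : measurable_fun setT h.
Proof. exact: (measurable_heat_kernel_increment _ _ _ _ _ stableX). Qed.

Let h0 z : (0 <= h z)%E.
Proof. by rewrite lee_fin heat_kernel_ge0. Qed.

Let D : set R := `[0, t]%classic.

Let mD : measurable D.
Proof. exact: measurable_itv. Qed.

Let H (z : T * R) := (\int[mu]_(r in D) h (z, r))%E.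

Let mH : measurable_fun setT H.
Proof. exact: (measurable_fun_tonelli_domain mu h D mh h0 mD). Qed.

Let H0 z : (0 <= H z)%E.
Proof. by apply: integral_ge0. Qed.

Let mhs s : measurable_fun setT (fun z : T * R => h ((z.1, s), z.2)).
Proof.
apply: (measurableT_comp mh (g := fun z : T * R => ((z.1, s), z.2))).
by apply: measurable_fun_pair => //; apply: measurable_fun_pair.
Qed.

Lemma expectation_self_intersection :
  (\int[P]_w self_intersection X t w =
   \int[mu]_(s in `[0%R, t]) \int[mu]_(r in `[0%R, t]) \int[P]_w
     (heat_kernel `|s - r| (subv (X s w) (X r w)))%:E)%E.
Proof.
(* The expectation first passes the [s]-integral, with the [r]-integral packed in [H]; then, for
   fixed [s], it passes the [r]-integral. *)
transitivity (\int[mu]_(s in D) \int[P]_w H (w, s))%E.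
  exact: (tonelli_domain P mu H D mH H0 mD).
apply: eq_integral => s _.
exact: (tonelli_domain P mu (fun z => h ((z.1, s), z.2)) D (mhs s) _ mD).
Qed.

Lemma expectation_self_intersection_infty :
  0 < alpha -> alpha <= 2 -> 0 < c -> (2 <= d)%N ->
  (\int[P]_w self_intersection X t w = +oo)%E.
Proof.
move=> alpha0 alpha2 c0 d2; rewrite expectation_self_intersection.
have [K K0 lowerK] := integral_heat_kernel_ge P alpha c d X stableX alpha0 alpha2 c0
  (ltnW d2) t t_gt0 d2.
pose g s := (\int[mu]_(r in `[0%R, t]) \int[P]_w
     (heat_kernel `|s - r| (subv (X s w) (X r w)))%:E)%E.
have g0 s : (0 <= g s)%E.
  by do 2 apply: integral_ge0 => ? _; rewrite lee_fin heat_kernel_ge0.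
(* The range [r < s] alone already diverges. It is empty at [s = 0], so the outer integral is
   afterwards restricted to [s > 0]. *)
have gy s : 0 < s <= t -> g s = +oo%E.
  move=> /andP[s0 st]; apply/eqP; rewrite -leye_eq.
  have minv : measurable_fun `[0%R, s[ (fun r : R => ((s - r)^-1)%:E).
    by apply: measurable_funS (measurable_inv_subl s) => //; exact: subset_itvr.
  apply: (@le_trans _ _ (\int[mu]_(r in `[0%R, s[) (K%:E * ((s - r)^-1)%:E))%E).
    rewrite ge0_integralZl_EFin ?(ltW K0)//.
    - by rewrite integral_inv_dist// gt0_muley ?lte_fin.
    - move=> r /=; rewrite in_itv/= => /andP[_ rs].
      by rewrite lee_fin invr_ge0 subr_ge0 ltW.
  apply: ge0_le_integral_subset => //.
  - by apply: subset_itvl; rewrite bnd_simp.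
  - move=> r /=; rewrite in_itv/= => /andP[_ rs].
    by rewrite -EFinM lee_fin mulr_ge0 ?(ltW K0)// invr_ge0 subr_ge0 ltW.
  - by move=> r _; apply: integral_ge0 => w _; rewrite lee_fin heat_kernel_ge0.
  - by move=> r /=; rewrite in_itv/= => /andP[r0 rs]; exact: lowerK.
apply/eqP; rewrite -leye_eq.
apply: (@le_trans _ _ (\int[mu]_(s in `]0%R, t]) g s)%E); last first.
  apply: ge0_le_integral_subset => //; last by move=> s _; exact: g0.
  by apply: subset_itvr; rewrite bnd_simp.
have -> : (\int[mu]_(s in `]0%R, t]) g s = \int[mu]_(s in `]0%R, t]) cst +oo s)%E.
  by apply: eq_integral => s; rewrite inE/= in_itv/= => /gy.
rewrite integral_cst//= lebesgue_measure_itv/= lte_fin t_gt0 -EFinB subr0.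
by rewrite gt0_mulye// lte_fin.
Qed.

End with_process.
End self_intersection_local_time.

Theorem theorem3p2 (R : realType) (dT : measure_display) (T : measurableType dT)
    (P : probability T R) (alpha c t : R) (d : nat) (X : R -> T -> 'I_d -> R) :
  0 < alpha -> alpha <= 2 -> (0 < d)%N -> 0 < t -> 0 < c ->
  is_stable_process P alpha c X ->
  ((\int[P]_w expeR (self_intersection X t w) < +oo)%E <-> d = 1%N).
Proof.
move=> alpha0 alpha2 d0 t0 c0 stableX; split=> [Efin|d1]; last first.
  (* [M] bounds the exponent for every [w], and [P] has finite mass. *)
  subst d; pose M := (2 * pi) `^ (- 2^-1) * (4 * Num.sqrt t) * t.
  apply: (@le_lt_trans _ _ (\int[P]_w (cst (expR M)%:E w))%E).
    apply: ge0_le_integral_subset => //.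
    - by move=> w _; exact: expeR_ge0.
    - by move=> w _; rewrite lee_fin expR_ge0.
    - by move=> w _; rewrite -[leRHS]/(expeR M%:E) lee_expeR self_intersection1_le.
  by rewrite integral_cst// lte_mul_pinfty ?lee_fin ?expR_ge0// ltey_eq fin_num_measure.
(* For [d >= 2], [y <= 1 + y <= expeR y] bounds the exponential moment below by the infinite first
   moment. *)
apply/eqP; rewrite eqn_leq d0 andbT leqNgt; apply/negP => d2.
move: Efin; apply/negP; rewrite -leNgt.
rewrite -(expectation_self_intersection_infty P alpha c d X t stableX t0 alpha0 alpha2 c0 d2).
apply: ge0_le_integral_subset => //.
- by move=> w _; exact: ge0_self_intersection.
- by move=> w _; exact: expeR_ge0.
- by move=> w _; apply: le_trans (expeR_ge1Dx _); rewrite leeDr.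
Qed.
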